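(* Let $0\le s\le d$ and let $\mathbb S^d$ be the pseudo-Euclidean space of signature parameter $s$. A graph $\Gamma$ is generically globally rigid in $\mathbb E^d$ if and only if it is generically globally rigid in $\mathbb S^d$.
   Context: For a fixed integer $0\le s\le d$, $\mathbb S^d$ denotes $\mathbb R^d$ with squared length $|w|^2=-\sum_{i=1}^s w_i^2+\sum_{i=s+1}^d w_i^2$; $\mathbb E^d$ is the case $s=0$. A graph $\Gamma$ has vertex set $\mathcal V$ ($v$ vertices) and edge set $\mathcal E$. A framework of $\Gamma$ in $\mathbb F^d$ ($\mathbb F\in\{\mathbb E,\mathbb S\}$) is a map $\rho:\mathcal V\to\mathbb R^d$. Frameworks $\rho,\sigma$ are equivalent if $|\rho(t)-\rho(u)|^2=|\sigma(t)-\sigma(u)|^2$ (in the relevant metric) for all edges $\{t,u\}$, and congruent if this holds for all pairs of vertices. A framework is globally rigid in $\mathbb F^d$ if every equivalent framework of $\Gamma$ in $\mathbb F^d$ is congruent to it. A framework is generic if its real coordinates satisfy no nonzero polynomial equation with rational coefficients. $\Gamma$ is generically globally rigid (GGR) in $\mathbb F^d$ if all generic frameworks of $\Gamma$ in $\mathbb F^d$ are globally rigid. *)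

(* Defs.v *)
From Stdlib Require Import Reals QArith List.
Open Scope R_scope.

(* Points of R^d: functions nat -> R, only coordinates 0..d-1 matter.
   Signature: coordinates 0..s-1 carry sign -1, coordinates s..d-1 sign +1. *)
Definition sgn (s i : nat) : R := if Nat.ltb i s then -1 else 1.

Definition sqlen (s d : nat) (w : nat -> R) : R :=
  fold_right Rplus 0 (map (fun i => sgn s i * (w i * w i)) (seq 0 d)).

(* A framework of a graph with vertex set {0,..,v-1} in R^d:
   rho t i = i-th coordinate of the position of vertex t. *)
Definition framework := nat -> nat -> R.

Definition sqdist (s d : nat) (rho : framework) (t u : nat) : R :=
  sqlen s d (fun i => rho t i - rho u i).

(* Graph: v vertices {0,..,v-1}, edge relation E (edges {t,u} with E t u). *)
Definition equivalent (s d v : nat) (E : nat -> nat -> Prop) (rho sigma : framework) : Prop :=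
  forall t u, (t < v)%nat -> (u < v)%nat -> E t u ->
    sqdist s d rho t u = sqdist s d sigma t u.

Definition congruent (s d v : nat) (rho sigma : framework) : Prop :=
  forall t u, (t < v)%nat -> (u < v)%nat ->
    sqdist s d rho t u = sqdist s d sigma t u.

Definition globally_rigid (s d v : nat) (E : nat -> nat -> Prop) (rho : framework) : Prop :=
  forall sigma : framework, equivalent s d v E rho sigma -> congruent s d v rho sigma.

Inductive qpoly : Type :=
| PConst : Q -> qpoly
| PVar : nat -> nat -> qpoly
| PAdd : qpoly -> qpoly -> qpoly
| PMul : qpoly -> qpoly -> qpoly.

Fixpoint peval (x : nat -> nat -> R) (p : qpoly) : R :=
  match p with
  | PConst q => Q2R q
  | PVar t i => x t i
  | PAdd p1 p2 => peval x p1 + peval x p2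
  | PMul p1 p2 => peval x p1 * peval x p2
  end.

Fixpoint vars_in (v d : nat) (p : qpoly) : Prop :=
  match p with
  | PConst _ => True
  | PVar t i => (t < v)%nat /\ (i < d)%nat
  | PAdd p1 p2 => vars_in v d p1 /\ vars_in v d p2
  | PMul p1 p2 => vars_in v d p1 /\ vars_in v d p2
  end.

(* p is the zero polynomial (over the infinite field R, same as vanishing identically) *)
Definition zero_poly (p : qpoly) : Prop := forall y, peval y p = 0.

Definition generic (v d : nat) (rho : framework) : Prop :=
  forall p : qpoly, vars_in v d p -> peval rho p = 0 -> zero_poly p.

Definition GGR (s d v : nat) (E : nat -> nat -> Prop) : Prop :=
  forall rho : framework, generic v d rho -> globally_rigid s d v E rho.

(* Main.v *)
(** If [rho] and [sigma] are equivalent and not congruent for one signature, apply to the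
pair ([rho_i], [sigma_i]), for every coordinate i whose sign has to change, the matrix
[[a, b], [b, a]] with a = (t^2 - 1) / 2t and b = (t^2 + 1) / 2t.  As b^2 - a^2 = 1, this
reverses the sign of the difference of the squared i-th coordinates, so the new pair is
equivalent and not congruent for the other signature.  It remains to choose the real t so that
the new first framework is generic.  A nonzero rational polynomial p, evaluated there, is a
Laurent polynomial in t.  At t = sqrt(-1), where a = sqrt(-1) and b = 0, its value is that of p
at [rho] with some coordinates multiplied by sqrt(-1), which is nonzero since [rho] is generic.
So each of the countably many p excludes only finitely many t. *)

Require Import Defs.
From Stdlib Require Import Reals QArith List.
From Stdlib Require Import Lra Lia Classical ClassicalEpsilon Cantor.
From mathcomp Require all_boot all_algebra ring Rstruct complex.

Local Open Scope R_scope.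

(** First component of the transformed pair; by the symmetry of the matrix, the second is
    [boost s t sigma rho]. *)
Definition boost (s : nat) (t : R) (rho sigma : framework) : framework :=
  fun u i =>
    if Nat.ltb i s
    then (t * t - 1) / (2 * t) * rho u i + (t * t + 1) / (2 * t) * sigma u i
    else rho u i.

(* Real and imaginary parts of p after multiplying the coordinates of index < s by i. *)
Fixpoint reim (s : nat) (p : qpoly) : qpoly * qpoly :=
  match p with
  | PConst q => (PConst q, PConst 0)
  | PVar u i =>
      if Nat.ltb i s then (PConst 0, PVar u i) else (PVar u i, PConst 0)
  | PAdd p1 p2 =>
      (PAdd (fst (reim s p1)) (fst (reim s p2)),
       PAdd (snd (reim s p1)) (snd (reim s p2)))
  | PMul p1 p2 =>
      (PAdd (PMul (fst (reim s p1)) (fst (reim s p2)))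
            (PMul (PConst (-1)) (PMul (snd (reim s p1)) (snd (reim s p2)))),
       PAdd (PMul (fst (reim s p1)) (snd (reim s p2)))
            (PMul (snd (reim s p1)) (fst (reim s p2))))
  end.

Lemma vars_in_reim s v d p :
  vars_in v d p -> vars_in v d (fst (reim s p)) /\ vars_in v d (snd (reim s p)).
Proof.
induction p as [q|u i|p1 IH1 p2 IH2|p1 IH1 p2 IH2]; simpl; try tauto.
now destruct (Nat.ltb i s).
Qed.

Lemma Q2R_0 : Q2R 0 = 0.
Proof. unfold Q2R; simpl; lra. Qed.

Lemma Q2R_N1 : Q2R (-1) = Ropp 1.
Proof. unfold Q2R; simpl; lra. Qed.

(** * Laurent polynomials in a complex boost parameter *)

Module ComplexEvaluation.
Import all_boot all_algebra ring Rstruct complex Defs.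
Import GRing.Theory Num.Theory.
Local Open Scope ring_scope.
Local Open Scope complex_scope.
Local Notation C := (R[i]).

Fixpoint ceval (x : nat -> nat -> C) (p : qpoly) : C :=
  match p with
  | PConst q => (Q2R q)%:C
  | PVar t i => x t i
  | PAdd p1 p2 => ceval x p1 + ceval x p2
  | PMul p1 p2 => ceval x p1 * ceval x p2
  end.

Lemma eq_ceval x y p : (forall u i, x u i = y u i) -> ceval x p = ceval y p.
Proof. by move=> xy; elim: p => //= p1 -> p2 ->. Qed.

Lemma ceval_real (x : framework) p : ceval (fun u i => (x u i)%:C) p = (peval x p)%:C.
Proof.
elim: p => //= p1 -> p2 ->; first by rewrite -rmorphD.
by rewrite -rmorphM.
Qed.

Lemma i_neq0 : 'i != 0 :> C.
Proof. by rewrite eq_complex /= oner_eq0 andbF. Qed.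

(** A pole is allowed at 0 only; the value [f 0] is left unconstrained. *)
Definition laurent (f : C -> C) :=
  exists (N : {poly C}) n, forall z : C, z != 0 -> N.[z] = z ^+ n * f z.

Lemma laurent_ceval (f : C -> nat -> nat -> C) p :
  (forall u i, laurent (fun z => f z u i)) -> laurent (fun z => ceval (f z) p).
Proof.
move=> fL; elim: p => /= [q|u i|p1 [N1 [n1 H1]] p2 [N2 [n2 H2]]|p1 [N1 [n1 H1]] p2 [N2 [n2 H2]]].
- by exists (Q2R q)%:C%:P, 0%N => z _; rewrite hornerC expr0 mul1r.
- exact: fL.
- exists ('X^n2 * N1 + 'X^n1 * N2), (n1 + n2)%N => z z0.
  by rewrite !hornerE H1 // H2 // exprD; ring.
- exists (N1 * N2), (n1 + n2)%N => z z0.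
  by rewrite hornerM H1 // H2 // exprD mulrACA.
Qed.

Definition twist (s : nat) (z : C) (x : framework) : nat -> nat -> C :=
  fun u i => if Nat.ltb i s then z * (x u i)%:C else (x u i)%:C.

Lemma laurent_twist s x u i : laurent (fun z => twist s z x u i).
Proof.
rewrite /twist; case: (Nat.ltb i s).
- by exists ((x u i)%:C *: 'X), 0%N => z _; rewrite !hornerE; ring.
- by exists (x u i)%:C%:P, 0%N => z _; rewrite !hornerE.
Qed.

Lemma ceval_twist_i s (x : framework) p :
  ceval (twist s 'i x) p = peval x (reim s p).1 +i* peval x (reim s p).2.
Proof.
elim: p => [q|u i|p1 IH1 p2 IH2|p1 IH1 p2 IH2].
- by rewrite /= Q2R_0.
- rewrite /= /twist; case: (Nat.ltb i s) => /=; rewrite Q2R_0 //.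
  by apply/eqP; rewrite eq_complex /=; apply/andP; split; apply/eqP; rewrite ?RealsE; ring.
- by rewrite /= IH1 IH2.
- rewrite /= IH1 IH2 Q2R_N1.
  by apply/eqP; rewrite eq_complex /=; apply/andP; split; apply/eqP; rewrite ?RealsE; ring.
Qed.

Lemma twist_scale s z (r : R) x u i :
  twist s z (fun u i => if Nat.ltb i s then r * x u i else x u i) u i
  = twist s (z * r%:C) x u i.
Proof. by rewrite /twist; case: (Nat.ltb i s) => //; rewrite rmorphM mulrA. Qed.

(* If p(i X) vanishes for all real X, then z |-> p(z X) vanishes on the
   imaginary axis, hence identically. *)
Lemma generic_twist_i s v d (x : framework) p :
  generic v d x -> vars_in v d p -> ceval (twist s 'i x) p = 0 -> zero_poly p.
Proof.
move=> gx pvd; rewrite ceval_twist_i => -[re0 im0].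
have [vre vim] := @vars_in_reim s v d p pvd.
(* Both parts are rational polynomials vanishing at the generic [x], hence zero; so p vanishes at
   [twist s 'i y] for every real [y]. *)
have zre := gx _ vre re0; have zim := gx _ vim im0.
have z0 y : ceval (twist s 'i y) p = 0 by rewrite ceval_twist_i zre zim.
move=> y.
have [N [n HN]] := @laurent_ceval (fun z => twist s z y) p (laurent_twist s y).
have i0 := i_neq0.
have N0 : N = 0.
  (* At ['i * k.+1] the twist of [y] is the ['i]-twist of [y] with its first [s] coordinates scaled
     by [k.+1], so these are [size N] distinct roots. The successor avoids z = 0, where [HN] says
     nothing. *)
  apply: (@roots_geq_poly_eq0 _ N [seq 'i * (k.+1)%:R | k <- iota 0 (size N)]).
  - apply/allP => _ /mapP[k _ ->]; apply/eqP; rewrite HN; last first.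
      by rewrite mulf_neq0 // pnatr_eq0.
    have -> : (k.+1)%:R = ((k.+1)%:R : R)%:C by rewrite rmorph_nat.
    by rewrite -(@eq_ceval _ _ p (twist_scale s 'i _ y)) z0 mulr0.
  - rewrite map_inj_uniq ?iota_uniq // => k l /(mulfI i0) /eqP.
    by rewrite eqr_nat => /eqP[].
  - by rewrite size_map size_iota.
(* At z = 1 the twist is [y] itself. *)
have := HN 1 (oner_neq0 _).
rewrite N0 horner0 expr1n mul1r (@eq_ceval _ (fun u i => (y u i)%:C)).
  by rewrite ceval_real => -[<-].
by move=> u i; rewrite /twist mul1r; case: (Nat.ltb i s).
Qed.

Definition cboost (s : nat) (z : C) (rho sigma : framework) : nat -> nat -> C :=
  fun u i =>
    if Nat.ltb i s
    then (z * z - 1) / (2%:R * z) * (rho u i)%:C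
         + (z * z + 1) / (2%:R * z) * (sigma u i)%:C
    else (rho u i)%:C.

Lemma C2_neq0 : 2%:R != 0 :> C.
Proof. by rewrite pnatr_eq0. Qed.

Lemma laurent_cboost s rho sigma u i : laurent (fun z => cboost s z rho sigma u i).
Proof.
rewrite /cboost; case: (Nat.ltb i s); last first.
  by exists (rho u i)%:C%:P, 0%N => z _; rewrite !hornerE.
exists (2%:R^-1 *: (((rho u i)%:C *: ('X * 'X - 1) + (sigma u i)%:C *: ('X * 'X + 1)))), 1%N.
by move=> z z0; rewrite !hornerE; field; rewrite z0 ?C2_neq0.
Qed.

Lemma cboost_real s (t : R) rho sigma u i :
  cboost s t%:C rho sigma u i = (boost s t rho sigma u i)%:C.
Proof.
rewrite /cboost /boost; case: (Nat.ltb i s) => //; rewrite ?RealsE.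
by rewrite !(rmorphD, rmorphM, rmorphN, fmorphV, rmorph1) mulr2n.
Qed.

Lemma cboost_i s rho sigma u i : cboost s 'i rho sigma u i = twist s 'i rho u i.
Proof.
rewrite /cboost /twist; case: (Nat.ltb i s) => //.
have ii : 'i * 'i = -1 :> C.
  by apply/eqP; rewrite eq_complex /=; apply/andP; split; apply/eqP; ring.
(* In this form the numerator cancels against [2 * 'i] and leaves ['i]. *)
have -> : 'i * 'i - 1 = 2%:R * ('i * 'i) :> C by rewrite ii; ring.
have -> : 'i * 'i + 1 = 0 :> C by rewrite ii addNr.
rewrite mul0r mul0r addr0 invfM mulrACA divff ?C2_neq0 // mul1r mulfK //.
exact: i_neq0.
Qed.

Lemma finite_nongeneric_boosts s v d rho sigma p :
  generic v d rho -> vars_in v d p -> ~ zero_poly p ->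
  exists l : list R, forall t : R, t <> 0%R ->
    peval (boost s t rho sigma) p = 0%R -> In t l.
Proof.
move=> grho pvd pnz.
have [N [n HN]] :=
  @laurent_ceval (fun z => cboost s z rho sigma) p (laurent_cboost s rho sigma).
have i0 := i_neq0.
(* Otherwise p would vanish at the boost with parameter ['i], which is the ['i]-twist of the generic
   [rho]. *)
have Nn0 : N != 0.
  apply/eqP => N0; apply: pnz; apply: (@generic_twist_i s v d rho) => //.
  rewrite -(@eq_ceval _ _ p (cboost_i s rho sigma)).
  move: (HN _ i0); rewrite N0 horner0 => /esym/eqP.
  by rewrite mulf_eq0 expf_eq0 (negPf i0) andbF => /eqP.
have [rs defN] := closed_field_poly_normal N.
(* A real root of [N] is its own real part; real parts of the non-real roots only enlarge the
   list. *)
exists (map (@complex.Re R) rs) => t /eqP t0 pt0.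
have : t%:C \in rs.
  have : root N t%:C.
    apply/eqP; rewrite HN; last by rewrite fmorph_eq0.
    by rewrite (@eq_ceval _ _ p (cboost_real s t rho sigma)) ceval_real pt0 mulr0.
  by rewrite defN rootZ ?lead_coef_eq0 // root_prod_XsubC.
elim: rs {defN} => //= z rs IH; rewrite in_cons => /orP[/eqP<-|/IH]; by [left|right].
Qed.

End ComplexEvaluation.

(** * Effect of a boost on squared distances *)

Lemma sqdist_boost (s1 s2 s d : nat) (t : R) (rho sigma : framework) (a b : nat) :
  t <> 0 ->
  (forall i, sgn s2 i = if Nat.ltb i s then - sgn s1 i else sgn s1 i) ->
  sqdist s2 d (boost s t rho sigma) a b - sqdist s2 d (boost s t sigma rho) a b
  = sqdist s1 d rho a b - sqdist s1 d sigma a b.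
Proof.
intros t0 Hs; unfold sqdist, sqlen; generalize (seq 0 d) as l.
induction l as [|i l IH]; simpl; [lra|].
match goal with |- ?x1 + ?y1 - (?x2 + ?y2) = ?x3 + ?y3 - (?x4 + ?y4) =>
  enough (x1 - x2 = x3 - x4) by lra end.
rewrite Hs; unfold boost; destruct (Nat.ltb i s); [field; exact t0 | ring].
Qed.

(** * Countability of the rational polynomials, uncountability of the reals *)

(** [Z.to_nat] sends negative integers to 0, so a numerator is recorded through both its positive
    and its negative part. *)
Fixpoint code (p : qpoly) : nat :=
  match p with
  | PConst q => to_nat (0%nat, to_nat (to_nat (Z.to_nat (Qnum q), Z.to_nat (- Qnum q)),
                                       Pos.to_nat (Qden q)))
  | PVar u i => to_nat (1%nat, to_nat (u, i))
  | PAdd p1 p2 => to_nat (2%nat, to_nat (code p1, code p2))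
  | PMul p1 p2 => to_nat (3%nat, to_nat (code p1, code p2))
  end.

Lemma code_inj p p' : code p = code p' -> p = p'.
Proof.
assert (inj : forall a b, to_nat a = to_nat b -> a = b).
{ intros a b H; rewrite <- (cancel_of_to a), H; apply cancel_of_to. }
revert p'; induction p as [[n m]|u i|p1 IH1 p2 IH2|p1 IH1 p2 IH2];
  intros [[n' m']|u' i'|p1' p2'|p1' p2'] H; cbn [code Qnum Qden] in H;
  apply inj in H; try discriminate H;
  apply (f_equal snd) in H; cbn [snd] in H; apply inj in H; apply pair_equal_spec in H as [H1 H2].
- apply inj, pair_equal_spec in H1; f_equal; f_equal; lia.
- now subst.
- now rewrite (IH1 _ H1), (IH2 _ H2).
- now rewrite (IH1 _ H1), (IH2 _ H2).
Qed.

(* The n-th value of [f] lies outside the (n+1)-st closed interval. *)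
Fixpoint avoiding_interval (f : nat -> R) (n : nat) : R * R :=
  match n with
  | O => (0, 1)
  | S n =>
      let a := fst (avoiding_interval f n) in
      let b := snd (avoiding_interval f n) in
      if Rlt_dec (f n) ((a + b) / 2) then ((a + b) / 2, b) else (a, (3 * a + b) / 4)
  end.

Lemma avoiding_interval_lt f n : fst (avoiding_interval f n) < snd (avoiding_interval f n).
Proof. induction n as [|n IH]; simpl; [|destruct (Rlt_dec _ _); simpl]; lra. Qed.

Lemma avoiding_interval_nested f n k :
  fst (avoiding_interval f n) <= fst (avoiding_interval f (k + n)) /\
  snd (avoiding_interval f (k + n)) <= snd (avoiding_interval f n).
Proof.
induction k as [|k IH]; simpl; [lra|].
pose proof (avoiding_interval_lt f (k + n)).
destruct (Rlt_dec _ _); simpl; lra.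
Qed.

(** Cantor's nested intervals: the supremum of the left endpoints lies in all of them. *)
Lemma real_not_enumerated (f : nat -> R) : exists x, forall n, f n <> x.
Proof.
assert (le : forall n m, fst (avoiding_interval f n) <= snd (avoiding_interval f m)).
{ intros n m.
  pose proof (avoiding_interval_lt f (m + n)).
  pose proof (avoiding_interval_nested f n m).
  pose proof (avoiding_interval_nested f m n).
  rewrite (Nat.add_comm n m) in *; lra. }
destruct (completeness (fun y => exists n, y = fst (avoiding_interval f n))) as [x [ub lub]].
- exists (snd (avoiding_interval f 0)); intros y [n ->]; apply le.
- now exists (fst (avoiding_interval f 0)), O.
- exists x; intros n E.
  assert (L : fst (avoiding_interval f (S n)) <= x) by (apply ub; now exists (S n)).
  assert (U : x <= snd (avoiding_interval f (S n))).
  { apply lub; intros y [m ->]; apply le. }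
  pose proof (avoiding_interval_lt f n).
  (* If [f n] is at least the midpoint, the next interval ends at the quarter point, so the midpoint
     itself is excluded too. *)
  simpl in L, U; destruct (Rlt_dec _ _); simpl in L, U; lra.
Qed.

(** * Choice of the parameter and transfer of rigidity *)

Lemma generic_boost s v d rho sigma :
  generic v d rho -> exists t, t <> 0 /\ generic v d (boost s t rho sigma).
Proof.
intro grho.
(* Indexing by codes makes the family of finite exceptional sets countable; each code belongs to at
   most one polynomial. *)
assert (L : forall n, exists l : list R, forall p, code p = n ->
  vars_in v d p -> ~ zero_poly p -> forall t, t <> 0 ->
  peval (boost s t rho sigma) p = 0 -> In t l).
{ intro n.
  destruct (classic (exists p, code p = n /\ vars_in v d p /\ ~ zero_poly p))
    as [[p [pn [pvd pnz]]]|no].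
  - destruct (ComplexEvaluation.finite_nongeneric_boosts s v d rho sigma p grho pvd pnz)
      as [l Hl].
    exists l; intros p' p'n _ _; rewrite <- pn in p'n.
    now rewrite (code_inj _ _ p'n).
  - exists nil; intros p pn pvd pnz; exfalso; apply no; now exists p. }
destruct (choice _ L) as [roots Hroots].
(* Entry 0 forces [t <> 0]; the others run through all pairs (code, position in its list), and
   positions past the end only repeat the value 0. *)
destruct (real_not_enumerated (fun n =>
  match n with
  | O => 0
  | S m => nth (snd (of_nat m)) (roots (fst (of_nat m))) 0
  end)) as [t Ht].
assert (t0 : t <> 0) by (intro E; now apply (Ht O)).
exists t; split; [exact t0|].
intros p pvd pt; apply NNPP; intro pnz.
destruct (In_nth _ _ 0 (Hroots (code p) p eq_refl pvd pnz t t0 pt)) as [k [_ Hk]].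
apply (Ht (S (to_nat (code p, k)))); rewrite cancel_of_to; exact Hk.
Qed.

(** Boosting carries equivalence from [s1] to [s2], and congruence comes back. The sign hypothesis
    is symmetric in [s1] and [s2], so this serves both directions of the equivalence. *)
Lemma GGR_sign_flip (s1 s2 s d v : nat) (E : nat -> nat -> Prop) :
  (forall i, sgn s2 i = if Nat.ltb i s then - sgn s1 i else sgn s1 i) ->
  GGR s2 d v E -> GGR s1 d v E.
Proof.
intros Hs ggr rho grho sigma equiv a b av bv.
destruct (generic_boost s v d rho sigma grho) as [t [t0 gt]].
pose proof (fun a b => sqdist_boost s1 s2 s d t rho sigma a b t0 Hs) as B.
enough (sqdist s2 d (boost s t rho sigma) a b = sqdist s2 d (boost s t sigma rho) a b)
  by (specialize (B a b); lra).
apply (ggr _ gt); [|exact av|exact bv].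
intros a' b' av' bv' e; specialize (equiv a' b' av' bv' e); specialize (B a' b'); lra.
Qed.

Theorem mainTheorem3 (s d : nat) (Hsd : (s <= d)%nat) (v : nat) (E : nat -> nat -> Prop) :
  GGR 0 d v E <-> GGR s d v E.
Proof.
split; apply GGR_sign_flip with (s := s); intro i; unfold sgn; simpl;
  destruct (Nat.ltb i s); lra.
Qed.
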